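(* Let $n\ge 2$, let $k\ge 1$ be an integer, and let $\mathbb{A}=\sum_{|\alpha|=k}A_\alpha\partial^\alpha$ be a homogeneous linear $k$th order constant-coefficient differential operator on $\mathbb{R}^n$ from $V$ to $W$ which is elliptic and boundary elliptic in some direction $\nu\in\mathbb{S}^{n-1}$. Then $\mathbb{A}$ is canceling, i.e. $$\bigcap_{\xi\in\mathbb{S}^{n-1}}\mathrm{im}\,\mathbb{A}(\xi)=\{0\}.$$
   Context: $V,W$ are finite-dimensional real inner product spaces and $A_\alpha\in\mathrm{Lin}(V,W)$ for multi-indices $\alpha\in\mathbb{N}_0^n$ with $|\alpha|=k$. The symbol is $\mathbb{A}(\xi)=\sum_{|\alpha|=k}\xi^\alpha A_\alpha\in\mathrm{Lin}(V,W)$ for $\xi\in\mathbb{R}^n$; the same formula for $\zeta\in\mathbb{C}^n$ gives a $\mathbb{C}$-linear map $\mathbb{A}(\zeta):V+\mathrm{i}V\to W+\mathrm{i}W$. $\mathbb{A}$ is elliptic if $\{v\in V:\mathbb{A}(\xi)v=0\}=\{0\}$ for all $\xi\in\mathbb{R}^n\setminus\{0\}$; it is boundary elliptic in direction $\nu$ if $\{v\in V+\mathrm{i}V:\mathbb{A}(\xi+\mathrm{i}\nu)v=0\}=\{0\}$ for all $\xi\in\mathbb{R}^n$. For $\xi\in\mathbb S^{n-1}$, $\mathrm{im}\,\mathbb{A}(\xi)=\mathbb{A}(\xi)[V]\subset W$. *)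

(* Defs.v *)
From HB Require Import structures.
From mathcomp Require Import all_boot all_order all_algebra.
From mathcomp Require Import complex mpoly.
From mathcomp Require Import classical_sets reals.

Set Implicit Arguments.
Unset Strict Implicit.
Unset Printing Implicit Defensive.

Import Order.TTheory GRing.Theory Num.Theory.
Local Open Scope ring_scope.
Local Open Scope classical_set_scope.

(* V + iV: the pair (u, w) stands for u + i w. *)
Definition complexification (R : realType) (V : lmodType R) : Type :=
  (V * V)%type.

Section Complexification.
Variables (R : realType) (V : lmodType R).

HB.instance Definition _ :=
  GRing.Zmodule.copy (complexification V) (V * V)%type.

Definition complexification_scale (c : R[i]) (v : complexification V) :
    complexification V :=
  (complex.Re c *: v.1 - complex.Im c *: v.2,
   complex.Re c *: v.2 + complex.Im c *: v.1).

Lemma complexification_scaleA c d v :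
  complexification_scale c (complexification_scale d v)
  = complexification_scale (c * d) v.
Proof.
case: c d v => [a b] [a' b'] [u w].
rewrite /complexification_scale /=; congr pair.
  rewrite scalerBr scalerDr scalerBl scalerDl !scalerA !opprD -!addrA.
  by congr (_ + _); rewrite addrA addrC.
rewrite scalerBr scalerDr scalerBl scalerDl !scalerA -!addrA.
by congr (_ + _); rewrite addrA addrC.
Qed.

Lemma complexification_scale1 : left_id 1 complexification_scale.
Proof.
by case=> u w; rewrite /complexification_scale /= !scale1r !scale0r subr0 addr0.
Qed.

Lemma complexification_scaleDr : right_distributive complexification_scale +%R.
Proof.
move=> c [u w] [u' w']; rewrite /complexification_scale /=; congr pair => /=.
  by rewrite !scalerDr opprD addrACA.
by rewrite !scalerDr addrACA.
Qed.

Lemma complexification_scaleDl v :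
  {morph complexification_scale^~ v : c d / c + d}.
Proof.
case: v => [u w] [a b] [a' b']; rewrite /complexification_scale /=.
congr pair => /=; first by rewrite !scalerDl opprD addrACA.
by rewrite !scalerDl addrACA.
Qed.

HB.instance Definition _ := GRing.Zmodule_isLmodule.Build R[i]
  (complexification V) complexification_scaleA complexification_scale1
  complexification_scaleDr complexification_scaleDl.

End Complexification.

Definition complexify (R : realType) (V W : lmodType R) (f : V -> W)
    (v : complexification V) : complexification W :=
  (f v.1, f v.2).

Lemma complexify_is_linear (R : realType) (V W : lmodType R)
  (f : {linear V -> W}) : linear (complexify f).
Proof.
move=> c u v; rewrite /complexify; congr pair => /=; rewrite linearD.
  by rewrite linearB !linearZ.
by rewrite linearD !linearZ.
Qed.

HB.instance Definition _ (R : realType) (V W : lmodType R)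
    (f : {linear V -> W}) :=
  GRing.isLinear.Build R[i] (complexification V) (complexification W) *:%R
    (complexify f) (complexify_is_linear f).

Definition monomial (K : comNzRingType) (n : nat) (x : 'rV[K]_n)
    (a : 'X_{1..n}) : K :=
  \prod_(i < n) x 0 i ^+ a i.

Definition unit_sphere (R : realType) (n : nat) : set 'rV[R]_n :=
  [set x | \sum_(i < n) x 0 i ^+ 2 = 1].

Section Operators.
Variables (R : realType) (n k : nat) (V W : vectType R).

(* A k-homogeneous constant-coefficient operator is given by its coefficients
   A a; those with mdeg a != k are never used. The index type 'X_{1..n < k.+1}
   only makes the sum over all a with mdeg a = k a finite one. *)
Implicit Types A : 'X_{1..n} -> 'Hom(V, W).

Definition symbol A (xi : 'rV[R]_n) : 'Hom(V, W) :=
  \sum_(a : 'X_{1..n < k.+1} | mdeg a == k) monomial xi a *: A a.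

Definition csymbol A (zeta : 'rV[R[i]]_n) (v : complexification V) :
    complexification W :=
  \sum_(a : 'X_{1..n < k.+1} | mdeg a == k)
    monomial zeta a *: complexify (A a) v.

Lemma csymbol_is_linear A zeta : linear (csymbol A zeta).
Proof.
move=> c u v; rewrite /csymbol scaler_sumr -big_split /=.
apply: eq_bigr => a _; rewrite scalerA mulrC -scalerA -scalerDr.
by congr (_ *: _); rewrite linearP.
Qed.

HB.instance Definition _ A zeta :=
  GRing.isLinear.Build R[i] (complexification V) (complexification W) *:%R
    (csymbol A zeta) (csymbol_is_linear A zeta).

Definition elliptic A : Prop :=
  forall xi : 'rV[R]_n, xi != 0 -> [set v | symbol A xi v = 0] = [set 0].

Definition boundary_elliptic A (nu : 'rV[R]_n) : Prop :=
  forall xi : 'rV[R]_n,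
    [set v | csymbol A (\row_j (xi 0 j +i* nu 0 j)%C) v = 0] = [set 0].

Definition canceling A : Prop :=
  \bigcap_(xi in @unit_sphere R n) range (symbol A xi) = [set 0].

End Operators.

(* Main.v *)
Require Import Defs.
From HB Require Import structures.
From mathcomp Require Import all_boot all_order all_algebra.
From mathcomp Require Import complex mpoly.
From mathcomp Require Import classical_sets reals.

(* Restrict the symbol to the complex line t |-> xi + t nu, where xi is not a
   multiple of nu. It is injective for every complex t: by ellipticity if t is
   real, and by boundary ellipticity and homogeneity otherwise. A vector w in
   the image for all real t has, by Cramer's rule, a preimage p(t) / q(t) with
   p, q polynomial, and injectivity at the roots of q lets one cancel them
   until q is constant. Since the coefficient of t^k in the symbol is A(nu),
   which is injective, and k >= 1, a nonzero p would give a symbol times p of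
   positive degree; so p = 0 and w = 0. *)

Set Implicit Arguments.
Unset Strict Implicit.
Unset Printing Implicit Defensive.

Import Order.TTheory GRing.Theory Num.Theory VectorInternalTheory.
Local Open Scope ring_scope.
Local Open Scope classical_set_scope.

(** * Matrices of polynomials and vectors common to all their images *)

Lemma poly_eq0_of_natr_roots (F : numDomainType) (p : {poly F}) :
  (forall j : nat, p.[j%:R] = 0) -> p = 0.
Proof.
move=> p0; apply: (@roots_geq_poly_eq0 _ _ [seq j%:R | j <- iota 0 (size p)]).
- by apply/allP=> _ /mapP[j _ ->]; apply/rootP/p0.
- by rewrite map_inj_uniq ?iota_uniq// => i j /eqP; rewrite eqr_nat => /eqP.
- by rewrite size_map size_iota.
Qed.

(** In the convolution sum every index other than [a] exceeds the bound on [p] or on [q]. Degree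
    bounds replace degrees because entries of the symbol may have degree below [k]. *)
Lemma coefM_top (R : nzSemiRingType) (p q : {poly R}) (a b : nat) :
  (size p <= a.+1)%N -> (size q <= b.+1)%N -> (p * q)`_(a + b) = p`_a * q`_b.
Proof.
move=> sp sq; have ltab : (a < (a + b).+1)%N by rewrite ltnS leq_addr.
rewrite coefM (bigD1 (Ordinal ltab)) //= addKn big1 ?addr0 // => i neq_ia.
have [lt_ia|gt_ia|eq_ia] := ltngtP i a.
- rewrite [q`__]nth_default ?mulr0 // (leq_trans sq) //.
  by rewrite -addnBAC ?(ltnW lt_ia) // -[ltnLHS]add0n ltn_add2r subn_gt0.
- by rewrite nth_default ?mul0r // (leq_trans sp).
- by case/eqP: neq_ia; apply: val_inj.
Qed.

Lemma size_mul_top (R : nzSemiRingType) (p q : {poly R}) (a b : nat) :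
  (size p <= a.+1)%N -> (size q <= b.+1)%N -> (size (p * q)%R <= (a + b).+1)%N.
Proof.
move=> sp sq; apply: leq_trans (size_polyMleq _ _) _.
by rewrite -subn1 leq_subLR add1n -addnS -addSn leq_add.
Qed.

(* Cramer's rule: a left inverse [L] of the specialization of [M] at [0] makes
   [M *m L] a square matrix with nonzero determinant. *)
Lemma polymx_preimage (F : numFieldType) (d m : nat)
    (M : 'M[{poly F}]_(d, m)) (w : 'rV[F]_m) :
  row_free (map_mx (horner_eval 0) M) ->
  (forall j : nat, exists v : 'rV_d, v *m map_mx (horner_eval j%:R) M = w) ->
  exists (p : 'rV[{poly F}]_d) (q : {poly F}),
    q != 0 /\ p *m M = q *: map_mx polyC w.
Proof.
move=> M0free Mw; pose L := pinvmx (map_mx (horner_eval 0) M).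
have evalC t (a b : nat) (B : 'M[F]_(a, b)) :
    map_mx (horner_eval t) (map_mx polyC B) = B.
  by apply/matrixP=> i j; rewrite !mxE /horner_eval hornerC.
pose N := M *m map_mx polyC L.
exists (map_mx polyC (w *m L) *m \adj N), (\det N); split.
  apply: contraTneq isT => detN0; have := congr1 (horner_eval 0) detN0.
  rewrite -det_map_mx map_mxM evalC mulmxVp // det1 raddf0 => /eqP.
  by rewrite oner_eq0.
apply/eqP; rewrite -subr_eq0; apply/eqP/matrixP=> i j; rewrite [RHS]mxE.
(* The naturals are infinitely many points. At each of them [w = v *m Mt], and [Mt *m L] times its
   adjugate is the scalar [\det (Mt *m L)], which can be pulled out. *)
apply: poly_eq0_of_natr_roots => t; have [v vM] := Mw t.
rewrite -horner_evalE.
set lhs := _ - _; suff : map_mx (horner_eval t%:R) lhs = 0.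
  by move/matrixP/(_ i j); rewrite mxE [RHS]mxE.
rewrite /lhs map_mxB !map_mxM map_mx_adj map_mxZ -det_map_mx !evalC map_mxM evalC.
set Mt := map_mx _ M in vM *.
rewrite -vM -(mulmxA v) -(mulmxA v) mul_mx_adj mul_mx_scalar -scalemxAl.
by rewrite subrr.
Qed.

(** A nonconstant [q] has a root [t]. There [p(t) M(t) = q(t) w = 0], so [p(t) = 0] by injectivity
    of [M(t)], and ['X - t%:P] divides [q] and every entry of [p]. Cancelling it lowers the degree
    of [q]. *)
Lemma polymx_preimage_descent (F : closedFieldType) (d m : nat)
    (M : 'M[{poly F}]_(d, m)) (w : 'rV[F]_m)
    (p : 'rV[{poly F}]_d) (q : {poly F}) :
  (forall t, row_free (map_mx (horner_eval t) M)) ->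
  q != 0 -> p *m M = q *: map_mx polyC w ->
  exists (p' : 'rV[{poly F}]_d) (q' : {poly F}),
    size q' = 1%N /\ p' *m M = q' *: map_mx polyC w.
Proof.
move=> Mfree; have [s] := ubnP (size q).
elim: s => // s IHs in p q * => lt_qs q0 pM.
have [sq|/closed_rootP[t qt]] := eqVneq (size q) 1%N; first by exists p, q.
have [q1 def_q] := factor_theorem _ _ qt.
have pt : map_mx (horner_eval t) p = 0.
  apply: (row_free_inj (Mfree t)); rewrite mul0mx -map_mxM pM map_mxZ /=.
  by rewrite /horner_eval (rootP qt) scale0r.
pose p1 := map_mx (fun f => f %/ ('X - t%:P)) p.
have def_p : p = ('X - t%:P) *: p1.
  apply/matrixP=> i j; rewrite !mxE mulrC divpK // -root_factor_theorem.
  by have /matrixP/(_ i j) := pt; rewrite !mxE => /rootP.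
have Xt0 := polyXsubC_eq0 t.
have q10 : q1 != 0 by apply: contraNneq q0 => q10; rewrite def_q q10 mul0r.
apply: (IHs p1 q1 _ q10).
  by rewrite def_q size_Mmonic ?monicXsubC // size_XsubC addn2 /= in lt_qs.
move: pM; rewrite def_p def_q -scalemxAl mulrC -scalerA => pM.
apply/matrixP=> i j; have /matrixP/(_ i j) := pM.
by rewrite [LHS]mxE [RHS]mxE => /mulfI; apply; rewrite Xt0.
Qed.

(** If the entries of [p] have degree at most [e], the coefficient of degree [e + k] in [p *m M] is
    the degree [e] coefficient of [p] times that of degree [k] of [M]. It vanishes since
    [e + k > 0], so injectivity lowers the bound on [p] until [p = 0]. *)
Lemma polymx_const_image (F : fieldType) (d m k : nat)
    (M : 'M[{poly F}]_(d, m)) (p : 'rV[{poly F}]_d) (c : 'rV[F]_m) :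
  (0 < k)%N -> (forall i j, (size (M i j) <= k.+1)%N) ->
  row_free (map_mx (coefp k) M) -> p *m M = map_mx polyC c -> p = 0.
Proof.
move=> k0 sM Mfree pM.
suff sp e : (forall i j, (size (p i j) <= e)%N) -> p = 0.
  apply: (sp (\max_(x : 'I_1 * 'I_d) size (p x.1 x.2))) => i j.
  by rewrite (leq_bigmax (i, j)).
elim: e => [|e IHe] sp.
  apply/matrixP=> i j; rewrite [RHS]mxE; apply/eqP.
  by rewrite -size_poly_eq0 -leqn0.
apply: IHe => i j; apply/leq_sizeP => l; rewrite leq_eqVlt => /predU1P[<-|lt_el].
  suff /matrixP/(_ i j) : map_mx (coefp e) p = 0 by rewrite !mxE.
  apply: (row_free_inj Mfree); rewrite mul0mx; apply/matrixP=> i' j'.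
  have /matrixP/(_ i' j') pMij := pM.
  transitivity (coefp (e + k) ((p *m M) i' j')).
    by rewrite !mxE /= coef_sum; apply: eq_bigr => l' _; rewrite !mxE /= coefM_top.
  by rewrite pMij !mxE /= coefC addn_eq0 (gtn_eqF k0) andbF.
by rewrite nth_default // (leq_trans (sp i j)).
Qed.

Lemma polymx_common_image (F : numClosedFieldType) (d m k : nat)
    (M : 'M[{poly F}]_(d, m)) (w : 'rV[F]_m) :
  (0 < k)%N -> (forall i j, (size (M i j) <= k.+1)%N) ->
  row_free (map_mx (coefp k) M) ->
  (forall t, row_free (map_mx (horner_eval t) M)) ->
  (forall j : nat, exists v : 'rV_d, v *m map_mx (horner_eval j%:R) M = w) ->
  w = 0.
Proof.
move=> k0 sM Mkfree Mfree Mw.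
have [p [q [q0 pM]]] := polymx_preimage (Mfree 0) Mw.
have [{q0}p' [q' [sq p'M]]] := polymx_preimage_descent Mfree q0 pM.
have /size_poly1P[c c0 def_q'] : size q' == 1%N by rewrite sq.
have {}p'M : p' *m M = map_mx polyC (c *: w).
  by rewrite p'M def_q' map_mxZ.
have p'0 := polymx_const_image k0 sM Mkfree p'M.
apply/matrixP=> i j; rewrite [RHS]mxE.
have /matrixP/(_ i j)/eqP := p'M; rewrite p'0 mul0mx !mxE eq_sym polyC_eq0.
by rewrite mulf_eq0 (negPf c0) => /eqP.
Qed.

(** * The symbol as a matrix acting on row vectors *)

Section SymbolMatrix.
Variables (R : realType) (n k : nat) (V W : vectType R).
Variable A : 'X_{1..n} -> 'Hom(V, W).

Definition lfun_mx (f : 'Hom(V, W)) : 'M[R]_(dim V, dim W) :=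
  lin1_mx (v2r \o f \o r2v).

Lemma mul_lfun_mx f v : v2r v *m lfun_mx f = v2r (f v).
Proof. by rewrite mul_rV_lin1 /= v2rK. Qed.

(** The ring [K] is left open so that one formula covers the real symbol, the complex symbol and the
    symbol at a vector of polynomials. Injectivity becomes [row_free]. *)
Definition symbol_mx (K : comNzRingType) (f : R -> K) (zeta : 'rV[K]_n) :
    'M[K]_(dim V, dim W) :=
  \sum_(a : 'X_{1..n < k.+1} | mdeg a == k)
    monomial zeta a *: map_mx f (lfun_mx (A a)).

Lemma mul_symbol_mx xi v :
  v2r v *m symbol_mx idfun xi = v2r (symbol k A xi v).
Proof.
rewrite /symbol_mx /symbol sum_lfunE mulmx_sumr linear_sum.
apply: eq_bigr => a _; rewrite -scalemxAr scale_lfunE [RHS]linearZ /=.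
by rewrite map_mx_id // mul_lfun_mx.
Qed.

Lemma map_monomial (K L : comNzRingType) (g : {rmorphism K -> L})
    (x : 'rV[K]_n) a : g (monomial x a) = monomial (map_mx g x) a.
Proof.
by rewrite rmorph_prod; apply: eq_bigr => i _; rewrite rmorphXn mxE.
Qed.

Lemma map_symbol_mx (K L : comNzRingType) (g : {rmorphism K -> L})
    (f : R -> K) zeta :
  map_mx g (symbol_mx f zeta) = symbol_mx (g \o f) (map_mx g zeta).
Proof.
rewrite map_mx_sum; apply: eq_bigr => a _.
by rewrite map_mxZ -map_monomial (map_mx_comp f g).
Qed.

Lemma monomialZ (K : comNzRingType) (c : K) (x : 'rV[K]_n) a :
  monomial (c *: x) a = c ^+ mdeg a * monomial x a.
Proof.
rewrite mdegE -prodrXr /monomial -big_split /=.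
by apply: eq_bigr => i _; rewrite mxE exprMn.
Qed.

(** Homogeneity serves twice: to reach the points [xi' + i nu] of boundary ellipticity, and to
    rescale real vectors to the unit sphere. *)
Lemma symbol_mxZ (K : comNzRingType) (f : R -> K) c zeta :
  symbol_mx f (c *: zeta) = c ^+ k *: symbol_mx f zeta.
Proof.
rewrite scaler_sumr; apply: eq_bigr => a /eqP deg_a.
by rewrite monomialZ deg_a scalerA.
Qed.

End SymbolMatrix.

(** * The symbol along a line, as a matrix of polynomials *)

Lemma coefX_top (R : nzSemiRingType) (p : {poly R}) (e : nat) :
  (size p <= 2)%N -> (size (p ^+ e)%R <= e.+1)%N /\ (p ^+ e)`_e = p`_1 ^+ e.
Proof.
move=> sp; elim: e => [|e [IHs IHc]]; first by rewrite !expr0 size_poly1 coef1.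
by rewrite !exprS -IHc -[e.+1]add1n size_mul_top // coefM_top.
Qed.

Lemma coef_prod_top (R : comNzRingType) (I : Type) (r : seq I)
    (F : I -> {poly R}) (d : I -> nat) :
  (forall i, (size (F i) <= (d i).+1)%N) ->
  (size (\prod_(i <- r) F i)%R <= (\sum_(i <- r) d i).+1)%N /\
  (\prod_(i <- r) F i)`_(\sum_(i <- r) d i) = \prod_(i <- r) (F i)`_(d i).
Proof.
move=> sF; elim: r => [|i r [IHs IHc]].
  by rewrite !big_nil size_poly1 coef1.
by rewrite !big_cons coefM_top // IHc size_mul_top.
Qed.

(** Each factor [x_i + X y_i] has degree at most 1 with coefficient [y_i] at [X], and [mdeg a] such
    factors are multiplied. *)
Lemma monomial_line_top (F : comNzRingType) (n : nat) (x y : 'rV[F]_n)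
    (a : 'X_{1..n}) (mon := monomial (map_mx polyC x + 'X *: map_mx polyC y) a) :
  (size mon <= (mdeg a).+1)%N /\ mon`_(mdeg a) = monomial y a.
Proof.
have s2 i : (size ((map_mx polyC x + 'X *: map_mx polyC y)%R 0%R i) <= 2)%N.
  rewrite !mxE mulrC (leq_trans (size_polyD _ _)) // geq_max.
  rewrite (leq_trans (size_polyC_leq1 _)) //=.
  by rewrite (@size_mul_top _ _ _ 0 1) ?size_polyC_leq1 ?size_polyX.
rewrite /mon /monomial mdegE.
have [|-> ->] := @coef_prod_top _ _ (index_enum 'I_n)
    (fun i => ((map_mx polyC x + 'X *: map_mx polyC y) 0%R i) ^+ a i) a.
  by move=> i; case: (coefX_top (a i) (s2 i)).
split=> //; apply: eq_bigr => i _; case: (coefX_top (a i) (s2 i)) => _ ->.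
by rewrite !mxE coefD coefC add0r mulrC coefCM coefX mulr1.
Qed.

Section SymbolMatrixLine.
Variables (R : realType) (n k : nat) (V W : vectType R).
Variable A : 'X_{1..n} -> 'Hom(V, W).
Variables (F : comNzRingType) (f : R -> F) (x y : 'rV[F]_n).

(** The indeterminate itself stands for the parameter of the line, which makes the whole family a
    single polynomial matrix. *)
Definition line_symbol_mx : 'M[{poly F}]_(dim V, dim W) :=
  symbol_mx k A (polyC \o f) (map_mx polyC x + 'X *: map_mx polyC y).

Lemma size_line_symbol_mx i j : (size (line_symbol_mx i j) <= k.+1)%N.
Proof.
rewrite /line_symbol_mx summxE; apply: (leq_trans (size_sum _ _ _)).
apply/bigmax_leqP => a /eqP deg_a; rewrite !mxE -[leqRHS]addn0 size_mul_top //.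
  by have [] := monomial_line_top x y a; rewrite deg_a.
exact: size_polyC_leq1.
Qed.

Lemma coef_line_symbol_mx :
  map_mx (coefp k) line_symbol_mx = symbol_mx k A f y.
Proof.
apply/matrixP => i j; rewrite mxE /line_symbol_mx !summxE /= coef_sum.
apply: eq_bigr => a /eqP deg_a; rewrite !mxE /= coefMC.
by have [_] := monomial_line_top x y a; rewrite deg_a => ->.
Qed.

Lemma horner_line_symbol_mx t :
  map_mx (horner_eval t) line_symbol_mx = symbol_mx k A f (x + t *: y).
Proof.
rewrite map_symbol_mx map_mxD map_mxZ /= -!map_mx_comp /horner_eval hornerX.
have hC : horner_eval t \o polyC =1 id by move=> c; rewrite /= /horner_eval hornerC.
rewrite !(map_mx_id hC); apply: eq_bigr => a _; congr (_ *: _).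
by apply/matrixP => i j; rewrite !mxE /= /horner_eval hornerC.
Qed.

End SymbolMatrixLine.

(** * Complex coordinates, and ellipticity as full row rank *)

Section Coordinates.
Variable R : realType.

Definition complex_v2r (U : vectType R) (u : complexification U) :
    'rV[R[i]]_(dim U) :=
  \row_j (v2r u.1 0 j +i* v2r u.2 0 j)%C.

Lemma complex_v2rE (U : vectType R) (u : complexification U) :
  complex_v2r u = map_mx (real_complex R) (v2r u.1) +
                  'i%C *: map_mx (real_complex R) (v2r u.2).
Proof. by apply/rowP => j; rewrite !mxE; simpc. Qed.

Lemma complex_v2r_is_linear (U : vectType R) : linear (@complex_v2r U).
Proof.
move=> [a b] u v; apply/rowP => j; rewrite !mxE /=.
rewrite !(linearD, linearZ, linearN) /= !mxE mulrN.
by simpc.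
Qed.

HB.instance Definition _ (U : vectType R) :=
  GRing.isLinear.Build R[i] (complexification U) 'rV[R[i]]_(dim U) *:%R
    (@complex_v2r U) (@complex_v2r_is_linear U).

Lemma complex_v2r_inj (U : vectType R) : injective (@complex_v2r U).
Proof.
move=> [u1 u2] [v1 v2] /rowP uv.
by congr pair; apply: v2r_inj; apply/rowP => j; have := uv j;
  rewrite !mxE => -[].
Qed.

Lemma complex_v2r_surj (U : vectType R) (x : 'rV[R[i]]_(dim U)) :
  exists u : complexification U, x = complex_v2r u.
Proof.
exists (r2v (map_mx (@complex.Re R) x), r2v (map_mx (@complex.Im R) x)).
by apply/rowP => j; rewrite !mxE /= !r2vK !mxE; case: (x 0 j).
Qed.

Variables (n k : nat) (V W : vectType R).
Variable A : 'X_{1..n} -> 'Hom(V, W).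

Lemma complex_v2r_complexify (f : 'Hom(V, W)) u :
  complex_v2r (complexify f u) =
  complex_v2r u *m map_mx (real_complex R) (lfun_mx f).
Proof.
by rewrite !complex_v2rE /= -!mul_lfun_mx !map_mxM mulmxDl scalemxAl.
Qed.

Lemma mul_csymbol_mx zeta u :
  complex_v2r u *m symbol_mx k A (real_complex R) zeta =
  complex_v2r (csymbol k A zeta u).
Proof.
rewrite mulmx_sumr [RHS]linear_sum; apply: eq_bigr => a _.
by rewrite -scalemxAr [RHS]linearZ /= complex_v2r_complexify.
Qed.

Lemma row_free_csymbol_mx zeta :
  [set v | csymbol k A zeta v = 0] = [set 0] ->
  row_free (symbol_mx k A (real_complex R) zeta).
Proof.
move=> ker0; apply: inj_row_free => x.
have [u ->] := complex_v2r_surj x; rewrite mul_csymbol_mx => Au0.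
have : [set v | csymbol k A zeta v = 0] u.
  by apply: complex_v2r_inj; rewrite Au0 linear0.
by rewrite ker0 => ->; rewrite linear0.
Qed.

Lemma symbol_mx_real xi :
  symbol_mx k A (real_complex R) (map_mx (real_complex R) xi) =
  map_mx (real_complex R) (symbol_mx k A idfun xi).
Proof. by rewrite map_symbol_mx. Qed.

Lemma row_free_symbol_mx xi :
  [set v | symbol k A xi v = 0] = [set 0] ->
  row_free (symbol_mx k A (real_complex R) (map_mx (real_complex R) xi)).
Proof.
(* Rank is unchanged by field extension, so injectivity over the reals suffices. *)
move=> ker0; rewrite symbol_mx_real row_free_map.
apply: inj_row_free => x; rewrite -[x]r2vK mul_symbol_mx => Ax0.
have : [set v | symbol k A xi v = 0] (r2v x).
  by apply: v2r_inj; rewrite Ax0 linear0.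
by rewrite ker0 => ->; rewrite linear0.
Qed.

(* [xi + t nu] is real for real [t], and a real multiple of some [xi' + i nu]
   otherwise. *)
Lemma row_free_complex_line (xi nu : 'rV[R]_n) (t : R[i]) :
  elliptic k A -> boundary_elliptic k A nu ->
  (forall s : R, xi + s *: nu != 0) ->
  row_free (symbol_mx k A (real_complex R)
    (map_mx (real_complex R) xi + t *: map_mx (real_complex R) nu)).
Proof.
move=> ellA bellA xinu; case: t => a b.
have [->|b0] := eqVneq b 0.
  rewrite -[(a +i* 0)%C]/(real_complex R a) -map_mxZ -map_mxD.
  exact/row_free_symbol_mx/ellA/xinu.
have -> : map_mx (real_complex R) xi + (a +i* b)%C *: map_mx (real_complex R) nu
    = real_complex R b *:
      \row_j ((b^-1 *: (xi + a *: nu)) 0 j +i* nu 0 j)%C.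
  by apply/rowP => j; rewrite !mxE; simpc; rewrite mulVKf.
rewrite symbol_mxZ /row_free mxrank_scale_nz ?expf_neq0 ?fmorph_eq0 //.
exact/row_free_csymbol_mx/bellA.
Qed.

End Coordinates.

(** * Choice of the line, and the theorem *)

Lemma exists_complement_line (F : fieldType) (n : nat) (nu : 'rV[F]_n) :
  (2 <= n)%N -> nu != 0 -> exists xi : 'rV[F]_n, forall s, xi + s *: nu != 0.
Proof.
move=> n2 /rV0Pn[i nui].
have [j jNi] : exists j : 'I_n, j != i.
  have /card_gt1P[j [l [_ _ jNl]]] : (1 < #|'I_n|)%N by rewrite card_ord.
  by have [eq_ji|] := eqVneq j i; [exists l; rewrite eq_sym -eq_ji | exists j].
(* Coordinate [i] of the sum is [s * nu_i], so its vanishing forces [s = 0]; coordinate [j] is then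
   1. *)
exists (delta_mx 0 j) => s; apply/eqP => /rowP xinu0.
have := xinu0 i; rewrite !mxE [i == j]eq_sym (negPf jNi) andbF add0r.
move=> /eqP; rewrite mulf_eq0 (negPf nui) orbF => /eqP s0.
by have /eqP := xinu0 j; rewrite !mxE s0 mul0r !eqxx addr0 oner_eq0.
Qed.

Lemma unit_sphere_normalize (R : realType) (n : nat) (x : 'rV[R]_n) :
  x != 0 -> exists2 r, r != 0 & unit_sphere (r *: x).
Proof.
move=> /rV0Pn[i xi].
have s_gt0 : 0 < \sum_(i < n) x 0 i ^+ 2.
  rewrite (bigD1 i) //= ltr_pwDl ?sumr_ge0 //.
    by rewrite lt_def sqrf_eq0 xi sqr_ge0.
  by move=> j _; rewrite sqr_ge0.
exists (Num.sqrt (\sum_(i < n) x 0 i ^+ 2))^-1.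
  by rewrite invr_eq0 gt_eqF // sqrtr_gt0.
rewrite /unit_sphere /=; under eq_bigr do rewrite mxE exprMn.
by rewrite -mulr_sumr exprVn sqr_sqrtr ?ltW // mulVf // gt_eqF.
Qed.

Theorem proposition5p1 (R : realType) (n k : nat) (V W : vectType R)
    (dotV : {dot V for idfun}) (dotW : {dot W for idfun})
    (A : mpoly.multinom n -> 'Hom(V, W)) :
  (2 <= n)%N -> (1 <= k)%N ->
  elliptic k A ->
  (exists2 nu : 'rV[R]_n, unit_sphere nu & boundary_elliptic k A nu) ->
  canceling k A.
Proof.
move=> n2 k1 ellA [nu nu1 bellA].
apply/seteqP; split=> [w wA|_ -> xi _]; last first.
  by exists 0 => //; rewrite linear0.
have nu0 : nu != 0.
  apply: contra_eq_neq nu1 => ->; rewrite big1 1?eq_sym ?oner_eq0 // => i _.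
  by rewrite mxE expr0n.
have [xi xinu] := exists_complement_line n2 nu0.
pose C := real_complex R.
pose M := line_symbol_mx k A C (map_mx C xi) (map_mx C nu).
(* The argument runs over the complex numbers, where every nonconstant denominator has a root. *)
suff : map_mx C (v2r w) = 0.
  rewrite -[X in _ = X](map_mx0 C) => /map_mx_inj /=.
  by rewrite -(linear0 v2r) => /v2r_inj.
apply: (@polymx_common_image _ _ _ k M) => //.
- exact: size_line_symbol_mx.
(* The coefficient of degree [k] is the symbol at [nu], injective by ellipticity as [nu != 0]. *)
- by rewrite coef_line_symbol_mx; apply/row_free_symbol_mx/ellA.
- by move=> t; rewrite horner_line_symbol_mx; apply: row_free_complex_line.
move=> j; rewrite horner_line_symbol_mx -(rmorph_nat C) -map_mxZ -map_mxD.
have [r r0 rxi] := unit_sphere_normalize (xinu j%:R).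
have [v _ <-] := wA _ rxi.
(* With [x = xi + j nu] and [r x] on the sphere, [w = A(r x) v = r^k A(x) v], so [r^k v] is a
   preimage of [w] under [A(x)]. *)
exists (map_mx C (r ^+ k *: v2r v)).
rewrite symbol_mx_real -map_mxM -mul_symbol_mx symbol_mxZ.
by rewrite -scalemxAl scalemxAr.
Qed.
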